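(* Let $(X,f)$ be a topological dynamical system satisfying the non-uniform periodic $\tau$-specification property. Then $$\frac{1}{1+\tau}h_{top}(f)\le\liminf_{n\to\infty}\frac1n\log|\mathrm{Per}_n(f)|.$$ If moreover $(X,f)$ is positively expansive, then $$\frac{1}{1+\tau}h_{top}(f)\le\liminf_{n\to\infty}\frac1n\log|\mathrm{Per}_n(f)|\le\limsup_{n\to\infty}\frac1n\log|\mathrm{Per}_n(f)|\le h_{top}(f).$$
   Context: Here $\tau\in[0,\infty]$; if $\tau=\infty$, $\frac1{1+\tau}h_{top}(f)$ is read as $0$. A topological dynamical system $(X,f)$ consists of a compact metric space $(X,d)$ with at least two points and a continuous map $f:X\to X$; $h_{top}(f)$ is topological entropy. $\mathrm{Per}_n(f)=\{x\in X:f^nx=x\}$ and $|S|$ denotes cardinality. $f$ is positively expansive if there is $\varepsilon_0>0$ such that $x\ne y$ implies $d(f^ix,f^iy)\ge\varepsilon_0$ for some integer $i\ge0$. Non-uniform periodic specification: $(X,f)$ has the non-uniform periodic specification property with gap function $M:\mathbb{N}\times(0,\infty)\to\mathbb{N}$ ($\mathbb{N}$ the positive integers) if $M(n,\varepsilon)$ is non-decreasing in $n$ and non-increasing in $\varepsilon$, and for every $\varepsilon>0$, every integer $k\ge2$, all $x_1,\dots,x_k\in X$ and all non-negative integers $a_1\le b_1<a_2\le b_2<\cdots<a_k\le b_k$ with $a_{i+1}-b_i\ge M(b_i-a_i+1,\varepsilon)$ for $1\le i\le k-1$: there is $z\in X$ with $d(f^{n-a_i}x_i,f^nz)\le\varepsilon$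 for all $a_i\le n\le b_i$, $1\le i\le k$; and moreover for every positive integer $p\ge b_k-a_1+M(b_k-a_k+1,\varepsilon)$ such a $z$ can be chosen with $f^pz=z$. Let $\mathscr{G}(X,f)$ be the set of all gap functions with which $(X,f)$ has the non-uniform periodic specification property, and $\tau(M)=\sup_{\varepsilon>0}\liminf_{n\to\infty}M(n,\varepsilon)/n\in[0,\infty]$. $(X,f)$ has the non-uniform periodic $\tau$-specification property if there is $M\in\mathscr{G}(X,f)$ with $\tau(M)=\tau$ and every $M'\in\mathscr{G}(X,f)$ satisfies $\tau(M')\ge\tau$. *)

(* Defs.v *)
From mathcomp Require Export all_boot all_order all_algebra.
From mathcomp Require Export all_classical all_reals all_analysis.

Set Implicit Arguments.
Unset Strict Implicit.
Unset Printing Implicit Defensive.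

Import Order.TTheory GRing.Theory Num.Theory.

Local Open Scope classical_set_scope.
Local Open Scope ring_scope.

Section Defs.
Context {R : realType} {X : metricType R}.
Implicit Types (f : X -> X) (M : nat -> R -> nat) (tau : \bar R).

Definition topological_dynamical_system f : Prop :=
  [/\ compact [set: X], exists x y : X, x <> y & continuous f].

Definition positively_expansive f : Prop :=
  exists2 e0 : R, 0 < e0 &
    forall x y : X, x <> y ->
      exists i : nat, e0 <= mdist (iter i f x) (iter i f y).

(* Topological entropy, in Bowen's form for a compact metric space:
   lim_(e -> 0+) limsup_n (1/n) log s_n(e), where s_n(e) is the largest
   cardinality of a set that is e-separated for the n-th Bowen metric. *)
Definition bowen_dist f (n : nat) (x y : X) : R :=
  \big[Num.max/0]_(i < n) mdist (iter i f x) (iter i f y).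

Definition separated_set f (n : nat) (e : R) (E : set X) : Prop :=
  forall x y : X, E x -> E y -> x <> y -> e < bowen_dist f n x y.

Definition max_separated f (n : nat) (e : R) : \bar R :=
  ereal_sup [set counting E | E in [set E | separated_set f n e E]].

Definition topological_entropy f : \bar R :=
  lim ((limn_esup (fun n : nat =>
          (n%:R^-1)%:E * lne (max_separated f n e))%E) @[e --> 0^'+]).

Definition Per f (n : nat) : set X := [set x | iter n f x = x].

(* (1/n) log |Per_n(f)|, in the extended reals: the value is +oo if
   Per_n(f) is infinite and -oo if it is empty (n > 0). *)
Definition per_growth f (n : nat) : \bar R :=
  ((n%:R^-1)%:E * lne (counting (Per f n)))%E.

(* A gap function is M : {1, 2, ...} x (0, oo) -> {1, 2, ...}; it is encoded
   as a function on nat x R of which only the values at n > 0, e > 0 matter. *)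
Definition gap_function M : Prop :=
  [/\ forall (n : nat) (e : R), (0 < n)%N -> 0 < e -> (0 < M n e)%N,
      forall (m n : nat) (e : R), (0 < m)%N -> (m <= n)%N -> 0 < e ->
        (M m e <= M n e)%N &
      forall (n : nat) (e e' : R), (0 < n)%N -> 0 < e -> e <= e' ->
        (M n e' <= M n e)%N].

Definition shadows f (e : R) (k : nat) (x : nat -> X) (a b : nat -> nat)
    (z : X) : Prop :=
  forall i n : nat, (i < k)%N -> (a i <= n <= b i)%N ->
    mdist (iter (n - a i) f (x i)) (iter n f z) <= e.

(* The k orbit segments are indexed from 0 to k - 1. *)
Definition periodic_specification_with_gap f M : Prop :=
  gap_function M /\
  forall (e : R) (k : nat) (x : nat -> X) (a b : nat -> nat),
    0 < e -> (2 <= k)%N ->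
    (forall i : nat, (i < k)%N -> (a i <= b i)%N) ->
    (forall i : nat, (i.+1 < k)%N -> (b i < a i.+1)%N) ->
    (forall i : nat, (i.+1 < k)%N ->
      (M (b i - a i + 1)%N e <= a i.+1 - b i)%N) ->
    (exists z : X, shadows f e k x a b z) /\
    (forall p : nat, (0 < p)%N ->
      (b k.-1 - a 0%N + M (b k.-1 - a k.-1 + 1)%N e <= p)%N ->
      exists z : X, shadows f e k x a b z /\ iter p f z = z).

Definition gap_rate M : \bar R :=
  ereal_sup [set limn_einf (fun n : nat => ((M n e)%:R / n%:R)%:E)
            | e in [set e : R | 0 < e]].

Definition periodic_tau_specification f tau : Prop :=
  (exists2 M, periodic_specification_with_gap f M & gap_rate M = tau) /\
  (forall M', periodic_specification_with_gap f M' -> (tau <= gap_rate M')%E).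

End Defs.

(* Main.v *)
(* A maximal (n, e/2)-separated set codes orbits of length m by m/n blocks, so
   for every single n the e-scale entropy h_e is at most (1/n) log s_n(e/2).
   Conversely, specification with gap M at scale e/4 turns every word of length
   k over an (n, e/2)-separated set into a different point of Per_p, for all
   p >= k (n - 1 + M(n, e/4)); hence log s_n(e/2) / (n - 1 + M(n, e/4)) is a
   lower bound for the growth of |Per_p|.  Choosing one n with
   M(n, e/4) / n < tau + delta gives h_e <= (1 + tau + delta) liminf.  Under
   positive expansiveness Per_n is (n, e)-separated for e below the constant,
   which bounds the growth from above. *)
Require Import Defs.
From mathcomp Require Import all_boot all_order all_algebra.
From mathcomp Require Import all_classical all_reals all_analysis.
From mathcomp Require Import ring zify.
Set Implicit Arguments.
Unset Strict Implicit.
Unset Printing Implicit Defensive.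
Import Order.TTheory GRing.Theory Num.Theory.
Import numFieldNormedType.Exports.
Local Open Scope classical_set_scope.
Local Open Scope ereal_scope.

(** * Limits, logarithms and cardinalities in the extended reals *)

Lemma le_limn_esup (R : realType) (u v : (\bar R)^nat) :
  (\forall n \near \oo, u n <= v n) -> limn_esup u <= limn_esup v.
Proof.
move=> uv; apply: le_ereal_inf_tmp => _ [V oV <-].
apply: (@le_trans _ _ (ereal_sup (u @` (V `&` [set n | u n <= v n])))).
  by apply: ereal_inf_lbound; exists (V `&` [set n | u n <= v n]) => //; exact: filterI.
apply: ge_ereal_sup => _ [n [Vn uvn] <-]; apply: le_trans uvn _.
by apply: ereal_sup_ubound; exists n.
Qed.

Lemma le_limn_einf (R : realType) (u v : (\bar R)^nat) :
  (\forall n \near \oo, u n <= v n) -> limn_einf u <= limn_einf v.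
Proof.
move=> uv; rewrite /limn_einf leeN2; apply: le_limn_esup.
by apply: filterS uv => n; rewrite leeN2.
Qed.

(** Comparison sequence for the growth rates: [b] absorbs the rounding of a number of blocks to an
    integer. *)
Lemma cvg_affine_inv (R : realType) (a b : R) :
  ((a + b * n%:R^-1)%:E @[n --> \oo] --> a%:E)%classic.
Proof.
have c0 : ((n%:R : R)^-1 @[n --> \oo] --> (0 : R))%classic%R.
  rewrite -cvg_shiftS; exact: cvg_harmonic.
apply: cvg_EFin; first exact: nearW.
have : ((a + b * n%:R^-1)%R @[n --> \oo] --> (a + b * 0)%R)%classic.
  by apply: cvgD; [exact: cvg_cst | apply: cvgMl_tmp].
by rewrite mulr0 addr0.
Qed.

Lemma le_lne (R : realType) (x y : \bar R) : x <= y -> lne x <= lne y.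
Proof.
move=> xy; have [x0|x0] := leP x 0; first by rewrite (le0_lneNy x0) leNye.
by rewrite lee_lne // in_itv /= ?leey ?andbT ?(ltW x0) // (le_trans (ltW x0)).
Qed.

Lemma lne_le_expeR (R : realType) (x y : \bar R) : (lne x <= y) = (x <= expeR y).
Proof.
apply/idP/idP => [xy|/le_lne]; last by rewrite expeRK.
have [x0|x0] := leP x 0; first exact: le_trans (expeR_ge0 _).
by rewrite -(@lneK _ x) ?lee_expeR// in_itv /= leey andbT ltW.
Qed.

Lemma counting_ge_card (R : realType) (X : choiceType) (A : set X)
    (T : finType) (g : T -> X) :
  injective g -> (forall t, A (g t)) -> (#|T|%:R : R)%:E <= counting A.
Proof.
move=> injg Ag; rewrite /counting; case: asboolP => finA; last exact: leey.
rewrite lee_fin ler_nat cardE -(size_map g); apply: uniq_leq_size.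
  by rewrite map_inj_uniq ?enum_uniq.
by move=> _ /mapP[t _ ->]; rewrite in_fset_set// inE.
Qed.

Lemma ge_natr_pinfty (R : realType) (u : \bar R) :
  (forall N : nat, exists2 n, (N <= n)%N & (n%:R : R)%:E <= u) -> u = +oo.
Proof.
move=> H; apply/eqyP => a a0; have [n /= an nu] := H (Num.bound a).
apply: le_trans nu; rewrite lee_fin; apply/ltW.
by apply: lt_le_trans (archi_boundP (ltW a0)) _; rewrite ler_nat.
Qed.

(** An infinite set contains arbitrarily large finite families, which force [u] to be +oo. *)
Lemma counting_le (R : realType) (X : choiceType) (A : set X) (u : \bar R) :
  (forall (N : nat) (g : 'I_N -> X), injective g -> (forall i, A (g i)) ->
    (N%:R : R)%:E <= u) -> counting A <= u.
Proof.
have sub (s : seq X) : uniq s -> {in s, forall x, A x} -> 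
    exists2 g : 'I_(size s) -> X, injective g & forall i, A (g i).
  move=> us sA; exists (tnth (in_tuple s)) => [|i]; first exact/tuple_uniqP.
  by apply: sA; exact: mem_tnth.
move=> H; rewrite /counting; case: asboolP => finA.
  have [||g injg Ag] := sub (finmap.enum_fset (fset_set A)).
    exact: finmap.fset_uniq.
    by move=> x; rewrite in_fset_set// inE.
  exact: H injg Ag.
rewrite leye_eq; apply/eqP/ge_natr_pinfty => N.
have [B BA NB] := infinite_set_fset N finA.
exists (size (finmap.enum_fset B)) => //.
have [||g injg Ag] := sub (finmap.enum_fset B).
- exact: finmap.fset_uniq.
- by move=> x /BA.
exact: H injg Ag.
Qed.

(** Otherwise [M n e / n] is at least [r] for all positive [n], and so is its lower limit. *)
Lemma gap_rate_lt (R : realType) (M : nat -> R -> nat) (r e : R) : (0 < e)%R ->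
  gap_rate M < r%:E -> exists2 n, (0 < n)%N & ((M n e)%:R < r * n%:R)%R.
Proof.
move=> e0 Mr; apply: contrapT => H; move: Mr; apply/negP; rewrite -leNgt.
apply: (@le_trans _ _ (limn_einf (fun n : nat => ((M n e)%:R / n%:R)%:E))); last first.
  by apply: ereal_sup_ubound; exists e.
have /cvg_limn_einf_sup[<- _] := @cvg_affine_inv R r 0.
apply: le_limn_einf; near=> n.
have n0 : (0 < n)%N by near: n; exact: nbhs_infty_gt.
rewrite mul0r addr0 lee_fin ler_pdivlMr ?ltr0n// leNgt; apply/negP => Mn.
by apply: H; exists n.
Unshelve. all: by end_near. Qed.

(** * Bowen metrics and separated families *)

Section Bowen.
Context {R : realType} {X : metricType R} (f : X -> X).

Lemma lt_bowen_distP (n : nat) (e : R) (x y : X) : (0 <= e)%R ->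
  (e < bowen_dist f n x y)%R <->
  exists2 i, (i < n)%N & (e < mdist (iter i f x) (iter i f y))%R.
Proof.
move=> e0; split=> [/bigmax_gtP[|[i _ ei]]|[i iltn ei]].
- by rewrite ltNge e0.
- by exists i.
- by apply/bigmax_gtP; right; exists (Ordinal iltn).
Qed.

Lemma bowen_dist_leP (n : nat) (e : R) (x y : X) : (0 <= e)%R ->
  (bowen_dist f n x y <= e)%R <->
  forall i, (i < n)%N -> (mdist (iter i f x) (iter i f y) <= e)%R.
Proof.
move=> e0; rewrite leNgt; split=> [/negP h i iltn|h].
  by rewrite leNgt; apply/negP => ei; apply/h/lt_bowen_distP => //; exists i.
by apply/negP => /lt_bowen_distP-/(_ e0)[i iltn]; rewrite ltNge h.
Qed.

Lemma bowen_dist_sym (n : nat) (x y : X) :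
  bowen_dist f n x y = bowen_dist f n y x.
Proof. by apply: eq_bigr => i _; rewrite metric_sym. Qed.

(** Indexing by a type lets coding maps between finite types do the counting. *)
Definition separated_family (n : nat) (e : R) (T : Type) (g : T -> X) : Prop :=
  forall s t, s <> t -> (e < bowen_dist f n (g s) (g t))%R.

Lemma separated_family_inj (n : nat) (e : R) (T : Type) (g : T -> X) :
  (0 <= e)%R -> separated_family n e g -> injective g.
Proof.
move=> e0 sg s t gst; apply: contrapT => /sg /(lt_bowen_distP _ _ _ e0)[i _].
by rewrite gst mdistxx ltNge e0.
Qed.

Lemma max_separated_ge (n : nat) (e : R) (T : finType) (g : T -> X) :
  (0 <= e)%R -> separated_family n e g -> #|T|%:R%:E <= max_separated f n e.
Proof.
move=> e0 sg; have injg := separated_family_inj e0 sg.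
apply: (@le_trans _ _ (counting (range g))).
  by apply: counting_ge_card injg _ => t; exists t.
apply: ereal_sup_ubound; exists (range g) => // _ _ [s _ <-] [t _ <-] gst.
by apply: sg => st; apply: gst; rewrite st.
Qed.

Lemma max_separated_le (n : nat) (e : R) (u : \bar R) :
  (forall (N : nat) (g : 'I_N -> X), separated_family n e g ->
    (N%:R : R)%:E <= u) -> max_separated f n e <= u.
Proof.
move=> H; apply: ge_ereal_sup => _ [E sE <-]; apply: counting_le => N g injg Eg.
by apply: H => s t st; apply: sE => // /injg.
Qed.

(** A bounded set of cardinalities has a largest element, so a supremum other than +oo is attained
    by a family. *)
Lemma max_separated_cases (n : nat) (e : R) : (0 <= e)%R ->
  max_separated f n e = +oo \/
  exists (N : nat) (g : 'I_N -> X),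
    separated_family n e g /\ max_separated f n e = N%:R%:E.
Proof.
move=> e0; pose P N := `[< exists g : 'I_N -> X, separated_family n e g >].
have [[m bP]|nb] := pselect (exists m, forall N, P N -> (N <= m)%N); [right|left].
  have P0 : exists N, P N.
    by exists 0%N; apply/asboolP;
      exists (fun i : 'I_0 => match notF (ltn_ord i) with end); case.
  case: (ex_maxnP P0 bP) => N /asboolP[g sg] maxN; exists N, g; split => //.
  apply/eqP; rewrite eq_le -{2}(card_ord N) (max_separated_ge e0 sg) andbT.
  apply: max_separated_le => N' g' sg'; rewrite lee_fin ler_nat maxN//.
  by apply/asboolP; exists g'.
apply: ge_natr_pinfty => N; apply: contrapT => nN; apply: nb; exists N => N'.
move=> /asboolP[g sg]; rewrite leqNgt; apply/negP => NN'; apply: nN.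
by exists N'; [exact: ltnW|rewrite -{1}(card_ord N') (max_separated_ge e0 sg)].
Qed.

End Bowen.

(** * Coding long orbits by blocks *)

Section Entropy.
Context {R : realType} {X : metricType R} (f : X -> X).

Lemma maximal_family_spans (n : nat) (e : R) (N : nat) (g : 'I_N -> X) :
  (0 <= e)%R -> separated_family f n e g -> max_separated f n e = N%:R%:E ->
  forall x, exists i, (bowen_dist f n x (g i) <= e)%R.
Proof.
move=> e0 sg maxN x; apply: contrapT => far.
have {}far i : (e < bowen_dist f n x (g i))%R.
  by rewrite ltNge; apply/negP => xi; apply: far; exists i.
(* A point far from all centres enlarges the family by one; [None] indexes it. *)
pose g' o := if o is Some i then g i else x.
have sg' : separated_family f n e g'.
  move=> [s|] [t|] // st /=; [|by rewrite bowen_dist_sym|exact: far].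
  by apply: sg => st'; apply: st; rewrite st'.
have := max_separated_ge e0 sg'.
by rewrite maxN card_option card_ord lee_fin ler_nat ltnn.
Qed.

(** A point is coded by centres [e / 2]-close to its iterates at multiples of [n]; two points with
    the same code stay within [e] before time [m]. The successor allows for an incomplete last
    block. *)
Lemma max_separated_le_expn (n m : nat) (e : R) (N : nat) (g : 'I_N -> X) :
  (0 <= e)%R -> (0 < n)%N ->
  (forall x, exists i, (bowen_dist f n x (g i) <= e / 2)%R) ->
  max_separated f m e <= (N ^ (m %/ n).+1)%:R%:E.
Proof.
move=> e0 n0 /choice[c cP]; apply: max_separated_le => K G sG.
pose phi k := [ffun i : 'I_(m %/ n).+1 => c (iter (i * n) f (G k))].
suff injphi : injective phi.
  by rewrite lee_fin ler_nat; have := leq_card phi injphi; rewrite card_ffun !card_ord.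
move=> s t st; apply: contrapT => /sG /(lt_bowen_distP _ _ _ _ e0)[i im].
apply/negP; rewrite -leNgt.
have iq : (i %/ n < (m %/ n).+1)%N by rewrite ltnS leq_div2r// ltnW.
have /ffunP/(_ (Ordinal iq)) := st; rewrite !ffunE /= => cst.
have e20 : (0 <= e / 2)%R by rewrite divr_ge0.
have rn : (i %% n < n)%N by rewrite ltn_mod.
have close k : (mdist (iter i f (G k))
    (iter (i %% n) f (g (c (iter (i %/ n * n) f (G k))))) <= e / 2)%R.
  have /(bowen_dist_leP _ _ _ _ e20)/(_ _ rn) := cP (iter (i %/ n * n) f (G k)).
  by rewrite -iterD addnC -divn_eq.
have := close t; rewrite -cst metric_sym => ht.
by rewrite (le_trans (metric_triangle _ _ _) (le_trans (lerD (close s) ht) _))// -splitr.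
Qed.

Definition separation_growth (e : R) : \bar R :=
  limn_esup (fun n => (n%:R^-1)%:E * lne (max_separated f n e)).

(* Coding an orbit of length m by its (m %/ n).+1 blocks of length n makes every
   single scale n an upper bound for the growth rate, so that the liminf in the
   gap rate may be met along any subsequence. *)
Lemma separation_growth_le (x0 : X) (n : nat) (e : R) : (0 <= e)%R -> (0 < n)%N ->
  separation_growth e <= (n%:R^-1)%:E * lne (max_separated f n (e / 2)).
Proof.
move=> e0 n0; have e20 : (0 <= e / 2)%R by rewrite divr_ge0.
have n0R : (0 < n%:R :> R)%R by rewrite ltr0n.
have [->|[N [g [sg maxN]]]] := max_separated_cases f n e20.
  by rewrite /= gt0_muley ?leey// lte_fin invr_gt0.
have spans := maximal_family_spans e20 sg maxN.
have N0 : (0 < N)%N by case: (spans x0) => i _; exact: leq_ltn_trans (ltn_ord i).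
have N0R : (0 < N%:R :> R)%R by rewrite ltr0n.
have lnN0 : (0 <= ln N%:R :> R)%R by rewrite ln_ge0// ler1n.
rewrite maxN lne_EFin// -EFinM.
have /cvg_limn_einf_sup[_ <-] := @cvg_affine_inv R (n%:R^-1 * ln N%:R) (ln N%:R).
apply: le_limn_esup; near=> m.
have m0 : (0 < m)%N by near: m; exact: nbhs_infty_gt.
have m0R : (0 < m%:R :> R)%R by rewrite ltr0n.
apply: (@le_trans _ _ ((m%:R^-1)%:E * lne (N ^ (m %/ n).+1)%:R%:E)).
  by rewrite lee_pmul2l ?lte_fin ?invr_gt0// le_lne//
    (max_separated_le_expn _ e0 n0 spans).
rewrite natrX lne_EFin ?exprn_gt0// lnXn// -EFinM lee_fin.
have qm : ((m %/ n)%:R / m%:R <= n%:R^-1 :> R)%R.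
  by rewrite ler_pdivrMr// ler_pdivlMl// mulrC -natrM ler_nat leq_trunc_div.
rewrite -[(ln _ *+ _)%R]mulr_natl -natr1
  [leLHS](_ : _ = ((m %/ n)%:R / m%:R + m%:R^-1) * ln N%:R)%R; last by ring.
by rewrite mulrDl [(ln _ * _)%R]mulrC lerD2r ler_wpM2r.
Unshelve. all: by end_near. Qed.

(** * Periodic points from specification *)

Lemma card_Per_ge (M : nat -> R -> nat) (n k p : nat) (e : R) (N : nat)
    (g : 'I_N -> X) :
  periodic_specification_with_gap f M -> (0 < n)%N -> (0 < e)%R ->
  separated_family f n (2 * e) g -> (1 < k)%N ->
  (k * (n.-1 + M n e) <= p)%N ->
  (N ^ k)%:R%:E <= (counting (Per f p) : \bar R).
Proof.
move=> [[Mpos _ _] spec] n0 e0 sg k2 Tp.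
have M0 := Mpos n e n0 e0.
have e20 : (0 <= 2 * e)%R by rewrite mulr_ge0// ltW.
(* A gap is counted from the last time of a block, [n - 1] after its start, so blocks can start
   every [T] steps. Closing the orbit costs one more gap, which makes [k * T] the exact threshold
   for [p]. *)
pose T := (n.-1 + M n e)%N; pose a i := (i * T)%N; pose b i := (a i + n.-1)%N.
have abn i : (b i - a i + 1 = n)%N by rewrite /b addnC addKn add1n prednK.
case: k k2 Tp => // k k2 Tp.
have /choice[z zP] (w : {ffun 'I_k.+1 -> 'I_N}) : exists z,
    shadows f e k.+1 (fun i => g (w (inord i))) a b z /\ iter p f z = z.
  have [|||||_ per] := spec e k.+1 (fun i => g (w (inord i))) a b => //.
  - by move=> i _; rewrite leq_addr.
  - by move=> i _; rewrite /b /a mulSn /T; lia.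
  - by move=> i _; rewrite abn /b /a mulSn /T; lia.
  by apply: per => /=; rewrite ?abn /b /a ?mul0n; move: Tp; rewrite mulSn -/T;
    move: (k * T)%N => q; rewrite /T; lia.
suff injz : injective z.
  have := @counting_ge_card R _ (Per f p) _ z injz (fun w => (zP w).2).
  by rewrite card_ffun !card_ord.
move=> w w' ww'; apply/ffunP => i; apply: contrapT => /sg.
move=> /(lt_bowen_distP _ _ _ _ e20)[j jn]; apply/negP; rewrite -leNgt.
(* A periodic point shared by two words would shadow both [i]-th letters within [e], putting them
   within [2 * e]. *)
have close (v : {ffun _}) : (mdist (iter j f (g (v i))) (iter (a i + j) f (z v)) <= e)%R.
  have := (zP v).1 i (a i + j)%N (ltn_ord i).
  by rewrite inord_val addKn; apply; rewrite leq_addr /b leq_add2l -ltnS prednK.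
have := close w'; rewrite -ww' metric_sym => h.
rewrite (le_trans (metric_triangle _ _ _) (le_trans (lerD (close w) h) _))//.
by rewrite mulr_natl mulr2n.
Qed.

(** Words of length [p %/ T] fit into every large period [p], and rounding loses less than one
    block, an error of order [1 / p] in the rate. *)
Lemma lne_max_separated_le (M : nat -> R -> nat) (n : nat) (e : R) :
  periodic_specification_with_gap f M -> (0 < n)%N -> (0 < e)%R ->
  ((n.-1 + M n e)%:R^-1)%:E * lne (max_separated f n (2 * e))
    <= limn_einf (per_growth f).
Proof.
move=> spec n0 e0; set T := (n.-1 + M n e)%N.
have T0 : (0 < T)%N by case: spec => [[/(_ n e n0 e0)]]; rewrite /T; lia.
have T0R : (0 < T%:R :> R)%R by rewrite ltr0n.
rewrite lee_pdivrMl// lne_le_expeR; apply: max_separated_le => N g sg.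
rewrite -lne_le_expeR -lee_pdivrMl//.
have [->|N0] := posnP N.
  by rewrite le0_lneNy// gt0_muleNy ?leNye// lte_fin invr_gt0.
have N0R : (0 < N%:R :> R)%R by rewrite ltr0n.
have lnN0 : (0 <= ln N%:R :> R)%R by rewrite ln_ge0// ler1n.
rewrite lne_EFin// -EFinM.
have /cvg_limn_einf_sup[<- _] := @cvg_affine_inv R (T%:R^-1 * ln N%:R) (- ln N%:R).
apply: le_limn_einf; near=> p.
(* Specification asks for at least two segments. *)
have Tp : (2 * T <= p)%N by near: p; exact: nbhs_infty_ge.
have p0 : (0 < p)%N by lia.
have p0R : (0 < p%:R :> R)%R by rewrite ltr0n.
have k2 : (1 < p %/ T)%N by rewrite leq_divRL.
apply: (@le_trans _ _ ((p%:R^-1)%:E * lne (N ^ (p %/ T))%:R%:E)); last first.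
  rewrite lee_pmul2l ?lte_fin ?invr_gt0// le_lne//.
  by apply: (card_Per_ge spec n0 e0 sg k2); rewrite leq_trunc_div.
rewrite natrX lne_EFin ?exprn_gt0// lnXn// -EFinM lee_fin.
have pT : (p%:R <= ((p %/ T)%:R + 1) * T%:R :> R)%R.
  by rewrite natr1 -natrM ler_nat ltnW// ltn_ceil.
have {}pT : (T%:R^-1 - p%:R^-1 <= (p %/ T)%:R / p%:R :> R)%R.
  by rewrite lerBlDr -[X in (_ + X)%R]mul1r -mulrDl ler_pdivlMr// ler_pdivrMl// mulrC.
rewrite -[(ln _ *+ _)%R]mulr_natl
  [leLHS](_ : _ = (T%:R^-1 - p%:R^-1) * ln N%:R)%R; last by ring.
by rewrite mulrA [(p%:R^-1 * _)%R]mulrC ler_wpM2r.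
Unshelve. all: by end_near. Qed.

(** * Entropy as a supremum over scales *)

Lemma le_max_separated (n : nat) (e e' : R) : (e <= e')%R ->
  max_separated f n e' <= max_separated f n e.
Proof.
move=> ee'; apply: ge_ereal_sup => _ [E sE <-]; apply: ereal_sup_ubound.
by exists E => // x y Ex Ey xy; apply: le_lt_trans ee' (sE _ _ Ex Ey xy).
Qed.

(** The growth is nonincreasing in [e], so its right limit at 0 is its supremum. *)
Lemma topological_entropyE : topological_entropy f =
  ereal_sup [set separation_growth e | e in [set` `]0%R, +oo[%R]].
Proof.
apply: (cvg_lim (@ereal_hausdorff R)).
apply: (@nonincreasing_at_right_cvge R separation_growth) => // e e' _ _ ee'.
apply: le_limn_esup; apply: nearW => n.
by apply: lee_wpmul2l; rewrite ?lee_fin ?invr_ge0// le_lne// le_max_separated.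
Qed.

Lemma topological_entropy_le (u : \bar R) :
  (forall e : R, (0 < e)%R -> separation_growth e <= u) ->
  topological_entropy f <= u.
Proof.
move=> H; rewrite topological_entropyE; apply: ge_ereal_sup => _ [e + <-].
by rewrite /= in_itv /= andbT => /H.
Qed.

Lemma separation_growth_le_entropy (e : R) : (0 < e)%R ->
  separation_growth e <= topological_entropy f.
Proof.
move=> e0; rewrite topological_entropyE; apply: ereal_sup_ubound.
by exists e => //; rewrite /= in_itv /= e0.
Qed.

(** * Upper and lower bounds for the growth of periodic points *)

Lemma per_growth_le_entropy : positively_expansive f ->
  limn_esup (per_growth f) <= topological_entropy f.
Proof.
move=> [e0 e0_gt0 expf].
(* Halving turns the weak inequality of expansiveness into the strict one of separation. *)
have e20 : (0 < e0 / 2)%R by rewrite divr_gt0.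
apply: le_trans (separation_growth_le_entropy e20).
apply: le_limn_esup; near=> n.
have n0 : (0 < n)%N by near: n; exact: nbhs_infty_gt.
apply: lee_wpmul2l; rewrite ?lee_fin ?invr_ge0// le_lne//.
apply: ereal_sup_ubound; exists (Per f n) => // x y px py xy.
have [i ei] := expf x y xy; apply/lt_bowen_distP; first exact: ltW.
(* The separating time may exceed [n]; periodicity reduces it modulo [n]. *)
have per z : Per f n z -> iter i f z = iter (i %% n) f z.
  move=> pz; rewrite {1}(divn_eq i n) addnC iterD; congr iter.
  by elim: (i %/ n)%N => // q IH; rewrite mulSn iterD IH.
exists (i %% n)%N; first by rewrite ltn_mod.
by rewrite -!per// (lt_le_trans _ ei)// ltr_pdivrMr// ltr_pMr// ltr1n.
Unshelve. all: by end_near. Qed.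

(** One-letter words give a periodic point for every large period, which keeps the logarithm away
    from -oo. *)
Lemma per_growth_ge0 (x0 : X) (M : nat -> R -> nat) :
  periodic_specification_with_gap f M -> 0 <= limn_einf (per_growth f).
Proof.
move=> spec.
have c0 : ((fun=> 0) : (\bar R)^nat) @ \oo --> (0 : \bar R) by exact: cvg_cst.
apply: (@le_trans _ _ (limn_einf (fun=> 0))).
  by rewrite (cvg_limn_einf_sup c0).1.
apply: le_limn_einf; near=> p.
rewrite mule_ge0 ?lee_fin ?invr_ge0// lne_ge0.
have := @card_Per_ge M 1 2 p 1 1 (fun=> x0) spec isT ltr01.
rewrite exp1n; apply=> //; first by move=> s t; rewrite !ord1.
by near: p; exact: nbhs_infty_ge.
Unshelve. all: by end_near. Qed.

Lemma entropy_le_per_growth (x0 : X) (tau : \bar R) :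
  0 <= tau -> periodic_tau_specification f tau ->
  (1 + tau)^-1 * topological_entropy f <= limn_einf (per_growth f).
Proof.
move=> tau0 [[M spec Mtau] _]; set L := limn_einf _.
have L0 : 0 <= L by exact: per_growth_ge0 spec.
case: tau tau0 Mtau => [t| |] // t0 Mtau; last by rewrite addey// invey mul0e.
have [->|Ly] := eqVneq L +oo; first exact: leey.
have Lfin : L \is a fin_num by rewrite ge0_fin_numE// ltey.
rewrite lee_fin in t0; have t10 : (0 < 1 + t)%R by rewrite ltr_pwDl.
rewrite -EFinD inver gt_eqF// lee_pdivrMl//; apply: topological_entropy_le => e e0.
rewrite -(fineK Lfin) -EFinM; apply/lee_addgt0Pr => d d0.
have l0 : (0 <= fine L)%R by exact: fine_ge0.
(* The slack in the gap rate ends up multiplied by [fine L]; the 1 keeps the denominator positive if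
   [L] is 0. *)
pose d' := (d / (fine L + 1))%R.
have d'0 : (0 < d')%R by rewrite divr_gt0// ltr_wpDl.
(* Shadowing at [e / 4] tells apart points that are more than [e / 2] apart, the scale at which
   block coding bounds [separation_growth e]. *)
have e40 : (0 < e / 4)%R by rewrite divr_gt0.
have [|n n0 Mn] := @gap_rate_lt R M (t + d') _ e40; first by rewrite Mtau lte_fin ltrDl.
have n0R : (0 < n%:R :> R)%R by rewrite ltr0n.
have := lne_max_separated_le spec n0 e40.
set T := (_ + _)%N; rewrite (_ : 2 * (e / 4) = e / 2)%R; last by field.
have T0R : (0 < T%:R :> R)%R.
  by rewrite ltr0n; case: spec => [[/(_ n _ n0 e40)]]; rewrite /T; lia.
rewrite lee_pdivrMl// => ST.
apply: le_trans (separation_growth_le x0 (ltW e0) n0) _.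
rewrite lee_pdivrMl//; apply: le_trans ST _.
rewrite -/L -(fineK Lfin) -EFinD -!EFinM lee_fin.
have TR : (T%:R <= (1 + t + d') * n%:R :> R)%R.
  have : (T <= n + M n (e / 4)%R)%N by rewrite /T; lia.
  rewrite -(ler_nat R) natrD => /le_trans; apply.
  by rewrite -addrA mulrDl mul1r lerD2l ltW.
apply: le_trans (ler_wpM2r l0 TR) _.
have dl : (d' * fine L <= d)%R.
  by rewrite /d' mulrAC ler_pdivrMr ?ltr_wpDl// ler_wpM2l ?lerDl// ltW.
rewrite [leLHS](_ : _ = n%:R * ((1 + t) * fine L + d' * fine L))%R; last by ring.
by rewrite ler_wpM2l ?lerD2l// ltW.
Qed.

End Entropy.

(* For tau = +oo, (1 + tau)^-1 = 0 and 0 * h = 0 for every extended real h. *)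
Theorem theorem9 (R : realType) (X : metricType R) (f : X -> X)
    (tau : \bar R) :
  topological_dynamical_system f ->
  0 <= tau ->
  periodic_tau_specification f tau ->
  (1 + tau)^-1 * topological_entropy f <= limn_einf (per_growth f) /\
  (positively_expansive f ->
    [/\ (1 + tau)^-1 * topological_entropy f <= limn_einf (per_growth f),
        limn_einf (per_growth f) <= limn_esup (per_growth f) &
        limn_esup (per_growth f) <= topological_entropy f]).
Proof.
move=> [_ [x0 _] _] tau0 spec.
have lower := entropy_le_per_growth x0 tau0 spec.
split=> // expf; split=> //; first exact: limn_einf_sup.
exact: per_growth_le_entropy.
Qed.
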